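(* Let $X$ be a reflexive subspace of a separable Banach space $E$ and let $\{x_i, z_i\}_{i=1}^{\infty}\subset X\times E^*$ be a bounded $M$-bibasic system. If $[z_i]$ is norming for $[x_i]$, then there exists a bounded sequence $\{f_i\}_i\subset E^*$ such that $\{x_i, f_i\}_i$ is a biorthogonal system and $[f_i]$ is norming for $E$.
   Context: $E^*$ denotes the dual space of $E$. For a sequence $\{y_i\}_i$ in a Banach space, $[y_i]$ denotes its closed (in norm) linear span. $B_Z$ denotes the unit ball of a normed space $Z$. - For a subspace $Y\subset E$ and a subspace $Z\subset E^*$, $Z$ is norming for $Y$ if the formula $|||x||| = \sup_{f\in B_Z}|f(x)|$, $x\in Y$, defines an equivalent norm on $Y$. $Z$ is total over $Y$ if the only $x\in Y$ with $f(x)=0$ for every $f\in Z$ is $x=0$. - A biorthogonal system in a Banach space $E$ is a sequence of pairs $\{x_i,z_i\}_{i=1}^\infty\subset E\times E^*$ with $z_i(x_j)=1$ if $i=j$ and $z_i(x_j)=0$ if $i\neq j$. The system is said to be bounded if $\sup_i\|x_i\|\,\|z_i\|<\infty$. - A sequence $\{x_i\}_{i=1}^\infty$ in a Banach space $F$ is a Markushevich basis ($M$-basis) of $F$ if $F=[x_i]$ and there exists a (unique) sequence $\{x_i^*\}_i\subset F^*$ such that $\{x_i,x_i^*\}_i$ is a biorthogonal system in $F$ and the subspace $[x_i^*]\subset F^*$ is total over $F$. - A biorthogonal system $\{x_i,z_i\}_{i=1}^\infty$ in $E$ is $M$-bibasic if $\{x_i\}_i$ is an $M$-basis of $[x_i]\subset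 E$ and $\{z_i\}_i$ is an $M$-basis of $[z_i]\subset E^*$.
   Formalization: Boundedness of {f_i} is proved when inf‖x_i‖>0 (necessary, as f_i(x_i)=1; it fails for x_i=e_i/i, z_i=i·e_i in ℓ_2); in general one gets that the biorthogonal system {x_i,f_i} is bounded, i.e. sup‖x_i‖‖f_i‖<∞. *)

(* Defs.v *)
From HB Require Import structures.
From mathcomp Require Import all_boot all_order all_algebra.
From mathcomp Require Import all_classical all_reals all_analysis.

Set Implicit Arguments.
Unset Strict Implicit.
Unset Printing Implicit Defensive.

Import Order.TTheory GRing.Theory Num.Theory.
Import numFieldNormedType.Exports.

Local Open Scope classical_set_scope.
Local Open Scope ring_scope.

Definition separable (T : topologicalType) :=
  exists D : set T, countable D /\ dense D.

(* A linear subspace is a predicate [Y : submodClosed V]; [subsp Y] is [Y] as a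
   normed space of its own, with the norm inherited from [V]. *)
Section Subspace.
Context {R : realType} {V : normedModType R} (Y : submodClosed V).

Record subsp := Subsp { subsp_val : V; subsp_valP : subsp_val \in Y }.

HB.instance Definition _ := [isSub for subsp_val].
HB.instance Definition _ := [Choice of subsp by <:].
HB.instance Definition _ := [SubChoice_isSubLmodule of subsp by <:].

Let nrm (y : subsp) : R := `|subsp_val y|.

Let nrmD (x y : subsp) : nrm (x + y) <= nrm x + nrm y.
Proof. exact: ler_normD. Qed.

Let nrmZ (a : R) (y : subsp) : nrm (a *: y) = `|a| * nrm y.
Proof. exact: normrZ. Qed.

Let nrm_eq0 (y : subsp) : nrm y = 0 -> y = 0.
Proof. by move=> /eqP; rewrite normr_eq0 => /eqP y0; exact: val_inj. Qed.

HB.instance Definition _ := Lmodule_isNormed.Build R subsp nrmD nrmZ nrm_eq0.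

End Subspace.

Section Dual.
Context {R : realType} (V : normedModType R).

Definition continuous_functional : {pred V -> R^o} :=
  fun f => `[< linear f /\ continuous f >].

Lemma continuous_functional_submod : submod_closed continuous_functional.
Proof.
split.
  apply/asboolP; split; first by move=> a u v /=; rewrite scaler0 addr0.
  exact: cst_continuous.
move=> a f g /asboolP[lf cf] /asboolP[lg cg]; apply/asboolP; split.
  move=> b u v; rewrite [LHS]/(a *: f (b *: u + v) + g (b *: u + v)) lf lg.
  rewrite [RHS]/(b *: (a *: f u + g u) + (a *: f v + g v)).
  by rewrite !scalerDr !scalerA (mulrC a b); exact: addrACA.
by move=> u; apply: cvgD; [apply: cvgZr; exact: cf|exact: cg].
Qed.

HB.instance Definition _ := GRing.isSubmodClosed.Build R (V -> R^o)
  continuous_functional continuous_functional_submod.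

Record dual := Dual
  { dual_val :> V -> R^o; dual_valP : dual_val \in continuous_functional }.

HB.instance Definition _ := [isSub for dual_val].
HB.instance Definition _ := [Choice of dual by <:].
HB.instance Definition _ := [SubChoice_isSubLmodule of dual by <:].

Lemma dual_linear (f : dual) : linear f.
Proof. by have /asboolP[] := dual_valP f. Qed.

HB.instance Definition _ (f : dual) :=
  GRing.isLinear.Build R V R^o _ (dual_val f) (@dual_linear f).

Lemma dual_continuous (f : dual) : continuous f.
Proof. by have /asboolP[] := dual_valP f. Qed.

Definition opnorm (f : dual) : R := sup [set `|f x| | x in [set x | `|x| <= 1]].

Let imgP (f : dual) : has_sup [set `|f x| | x in [set x | `|x| <= 1]].
Proof.
split; first by exists `|f 0|, 0 => //=; rewrite normr0 ler01.
have /linear_bounded_continuous/bounded_funP/(_ 1)[M fM] :=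
  @dual_continuous f.
by exists M => _ [x /= x1 <-]; exact: fM.
Qed.

Lemma le_opnorm (f : dual) (x : V) : `|f x| <= opnorm f * `|x|.
Proof.
have [->|x0] := eqVneq x 0; first by rewrite linear0 !normr0 mulr0.
have nx0 : 0 < `|x| by rewrite normr_gt0.
rewrite -ler_pdivrMr //; apply: ub_le_sup; first by case: (imgP f).
exists (`|x|^-1 *: x) => /=.
  by rewrite normrZ normfV normr_id mulVf ?gt_eqF.
by rewrite linearZ /= normrZ normfV normr_id mulrC.
Qed.

Let opnormD (f g : dual) : opnorm (f + g) <= opnorm f + opnorm g.
Proof.
apply: ge_sup; first by case: (imgP (f + g)).
move=> _ [x /= x1 <-]; apply: le_trans (ler_normD _ _) _.
by apply: lerD; apply: ub_le_sup; [case: (imgP f)|exists x|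
  case: (imgP g)|exists x].
Qed.

Let opnorm_ge0 (f : dual) : 0 <= opnorm f.
Proof.
apply: (@le_trans _ _ `|f 0|) => //; apply: ub_le_sup; first by case: (imgP f).
by exists 0 => //=; rewrite normr0 ler01.
Qed.

Let opnormZ_le (a : R) (f : dual) : opnorm (a *: f) <= `|a| * opnorm f.
Proof.
apply: ge_sup; first by case: (imgP (a *: f)).
move=> _ [x /= x1 <-]; rewrite [X in `|X|](_ : _ = a *: f x) // normrZ.
apply: ler_wpM2l => //; apply: ub_le_sup; first by case: (imgP f).
by exists x.
Qed.

Let opnormZ (a : R) (f : dual) : opnorm (a *: f) = `|a| * opnorm f.
Proof.
apply/eqP; rewrite eq_le opnormZ_le /=.
have [->|a0] := eqVneq a 0; first by rewrite normr0 mul0r opnorm_ge0.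
have := opnormZ_le a^-1 (a *: f).
rewrite scalerA mulVf // scale1r normfV => h.
by rewrite -ler_pdivlMl // normr_gt0.
Qed.

Let opnorm_eq0 (f : dual) : opnorm f = 0 -> f = 0.
Proof.
move=> f0; apply/val_inj/funext => x /=; apply/eqP; rewrite -normr_le0.
by have := le_opnorm f x; rewrite f0 mul0r.
Qed.

HB.instance Definition _ :=
  Lmodule_isNormed.Build R dual opnormD opnormZ opnorm_eq0.

End Dual.

(* Surjectivity of the canonical map [F -> F**]. *)
Definition reflexive_space {R : realType} (F : normedModType R) :=
  forall phi : dual (dual F), exists x : F, forall f : dual F, phi f = f x.

Section ClosedSpan.
Context {R : realType} {V : normedModType R} (y : nat -> V).

Definition lin_span : set V :=
  [set v | exists (n : nat) (a : nat -> R), v = \sum_(i < n) a i *: y i].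

Definition clspan : {pred V} := fun v => v \in closure lin_span.

Lemma lin_span_submod (a : R) (u v : V) :
  lin_span u -> lin_span v -> lin_span (a *: u + v).
Proof.
move=> [m [b ->]] [n [c ->]].
pose cut k (d : nat -> R) i := if (i < k)%N then d i else 0.
have cutE k (d : nat -> R) : (k <= maxn m n)%N ->
    \sum_(i < k) d i *: y i = \sum_(i < maxn m n) cut k d i *: y i.
  move=> kmn; rewrite (big_ord_widen _ (fun i => d i *: y i) kmn) big_mkcond /=.
  by apply: eq_bigr => i _; rewrite /cut; case: ifP => // _; rewrite scale0r.
exists (maxn m n), (fun i => a * cut m b i + cut n c i).
rewrite (cutE m) ?leq_maxl // (cutE n) ?leq_maxr // scaler_sumr -big_split /=.
by apply: eq_bigr => i _; rewrite scalerDl scalerA.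
Qed.

Lemma clspan_submod : submod_closed clspan.
Proof.
split.
  apply/mem_set/subset_closure; exists 0%N, (fun=> 0).
  by rewrite big_ord0.
move=> a u v /set_mem cu /set_mem cv; apply/mem_set => B Bauv.
have /(_ _ Bauv) : (fun p : V * V => a *: p.1 + p.2) @ (u, v) --> a *: u + v.
  by apply: cvgD; [apply: cvgZr; exact: cvg_fst|exact: cvg_snd].
move=> [[P Q] /= [Pu Qv] PQ].
have [p [sp Pp]] := cu _ Pu; have [q [sq Qq]] := cv _ Qv.
exists (a *: p + q); split; first exact: lin_span_submod.
exact: (PQ (p, q)).
Qed.

HB.instance Definition _ := GRing.isSubmodClosed.Build R V clspan clspan_submod.

Lemma mem_clspan (i : nat) : y i \in clspan.
Proof.
apply/mem_set/subset_closure; exists i.+1, (fun j => (j == i)%:R).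
rewrite (bigD1 ord_max) //= eqxx scale1r big1 ?addr0 // => j ji.
rewrite (_ : (j == i :> nat) = false) ?scale0r //.
by apply: contraNF ji => /eqP ji; apply/eqP/val_inj.
Qed.

Definition in_clspan (i : nat) : subsp clspan := Subsp (mem_clspan i).

End ClosedSpan.

Section Systems.
Context {R : realType}.

Definition equivalent_norm_on {V : normedModType R} (Y : {pred V})
    (p : V -> R) :=
  [/\ {in Y &, forall x y, p (x + y) <= p x + p y},
      forall a : R, {in Y, forall x, p (a *: x) = `|a| * p x},
      {in Y, forall x, p x = 0 -> x = 0} &
      exists c C : R, [/\ 0 < c, 0 < C &
        {in Y, forall x, c * `|x| <= p x <= C * `|x|}]].

Definition norming {V : normedModType R} (Z : {pred dual V}) (Y : {pred V}) :=
  equivalent_norm_on Y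
    (fun x => sup [set `|f x| | f in [set f : dual V | f \in Z /\ `|f| <= 1]]).

Definition total {V : normedModType R} (Z : {pred dual V}) (Y : {pred V}) :=
  {in Y, forall x, {in Z, forall f : dual V, f x = 0} -> x = 0}.

Definition biorthogonal {V : normedModType R} (x : nat -> V)
    (z : nat -> dual V) :=
  forall i j, z i (x j) = (i == j)%:R.

(* Invariant under [x i := t i *: x i], [z i := (t i)^-1 *: z i]; it bounds [z]
   itself as soon as [x] is bounded away from 0. *)
Definition bounded_system {V : normedModType R} (x : nat -> V)
    (z : nat -> dual V) :=
  has_ubound (range (fun i => `|x i| * `|z i|)).

(* The members of [xs] are functionals on [F] itself: for the basis [in_clspan x]
   of a closed span they live in the dual of [subsp (clspan x)]. *)
Definition M_basis {F : normedModType R} (x : nat -> F) :=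
  (forall v : F, v \in clspan x) /\
  exists xs : nat -> dual F, biorthogonal x xs /\ total (clspan xs) predT.

Definition M_bibasic {V : normedModType R} (x : nat -> V) (z : nat -> dual V) :=
  [/\ biorthogonal x z, M_basis (in_clspan x) & M_basis (in_clspan z)].

End Systems.

(* Main.v *)
Require Import Defs.
From HB Require Import structures.
From mathcomp Require Import all_boot all_order all_algebra.
From mathcomp Require Import all_classical all_reals all_analysis.
From mathcomp Require Import ring lra.
Import Order.TTheory GRing.Theory Num.Theory.
Import numFieldNormedType.Exports.
Local Open Scope classical_set_scope.
Local Open Scope ring_scope.

(** Write [F] for the closed span of the [x i] and [W] for that of the [z i].
   The [f i] have to agree with the [z i] on [F], so they are sought in the form
   [f i = z i + `|x i|^-1 *: h (k i)] with functionals [h m] of norm at most 1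
   that vanish on [F]; this already gives biorthogonality and boundedness.

   The first point is that every bidual functional [phi] acts on [W] as the
   evaluation at a point of [F] ([bidual_eval_on]).  Indeed [F] is reflexive,
   being closed in [X] ([reflexive_subspace]).  As [W] is norming for [F], every
   functional on [F] lifts to an element of [W] of comparable norm
   ([norming_lift]); the lift is unique because the coefficient functionals of
   the M-basis [z] are the evaluations at the [x i], and these are total over
   [W] ([Mbasis_clspan_total]).  So [W] is isomorphic to the dual of [F], and
   [phi], read on that dual, is an evaluation by reflexivity.

   Consequently [`|x i| *: z i] tends weakly to 0: it is bounded, and it is
   eventually 0 at each [x j], so it tends to 0 at every point of [F]
   ([bounded_system_eval_small]).  Let the index map [k] take each value [m]
   infinitely often.  Along those [i] with [k i = m], the vectors
   [`|x i| *: f i = `|x i| *: z i + h m] tend weakly to [h m], so by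
   Hahn-Banach [h m] lies in the closed span of the [f i]
   ([perturbation_in_clspan]); hence so do all the [z i], and all of [W].

   It remains to choose the [h m] so that they see the distance to [F].  Given a
   dense sequence [d], Hahn-Banach provides [h m] with [h m (d m)] equal to the
   distance from [d m] to [F] ([hahn_banach_dist]).  A vector far from [F] is
   then normed by some [h m]; a vector close to [F] is normed by [W]
   ([norming_extend]). *)

(** * The Hahn-Banach theorem *)

Section HahnBanach.
Set Implicit Arguments.
Unset Strict Implicit.
Context {R : realType}.

(** A partial functional on a subspace is encoded by its graph: unions of chains
   are then plain unions, and no domain has to be carried along. *)
Definition graph_linear {V : lmodType R} (G : set (V * R)) :=
  forall (a : R) u v r s, G (u, r) -> G (v, s) -> G (a *: u + v, a * r + s).

Definition graph_below {V : lmodType R} (p : V -> R) (G : set (V * R)) :=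
  forall v r, G (v, r) -> r <= p v.

(** One-dimensional extension: the admissible values [c] at [v0] lie between the
   numbers [r - p (u - v0)] and [p (w + v0) - s] for [(u, r)] and [(w, s)] in
   [G], and subadditivity puts all the former below all the latter. *)
Lemma graph_extend (V : lmodType R) (p : V -> R)
    (pD : forall u v, p (u + v) <= p u + p v)
    (pZ : forall a v, 0 <= a -> p (a *: v) = a * p v)
    (G : set (V * R)) (v0 : V) :
  G (0, 0) -> graph_linear G -> graph_below p G ->
  exists c, graph_below p
    [set q | exists u r t, G (u, r) /\ q = (u + t *: v0, r + t * c)].
Proof.
move=> G0 Glin Gp.
have GZ a u r : G (u, r) -> G (a *: u, a * r).
  by move=> Gu; have := Glin a u 0 r 0 Gu G0; rewrite !addr0.
pose A := [set c | exists u r, G (u, r) /\ c = r - p (u - v0)].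
have ubA w s : G (w, s) -> ubound A (p (w + v0) - s).
  move=> Gw _ [u [r [Gu ->]]].
  have := Gp _ _ (Glin 1 u w r s Gu Gw); rewrite scale1r mul1r => rs.
  have := pD (u - v0) (w + v0).
  rewrite (_ : u - v0 + (w + v0) = u + w) => [|]; first lra.
  by rewrite addrACA addNr addr0.
have A0 : A !=set0 by exists (0 - p (0 - v0)), 0, 0.
exists (sup A) => _ _ [u [r [t [Gu [-> ->]]]]].
have supA w s : G (w, s) -> s - p (w - v0) <= sup A <= p (w + v0) - s.
  move=> Gw; apply/andP; split; last exact: ge_sup (ubA _ _ Gw).
  by apply: ub_le_sup; [exists (p (0 + v0) - 0); exact: ubA | exists w, s].
have [t0|t0|->] := ltgtP t 0.
- have t1 : 0 < - t by rewrite oppr_gt0.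
  have /andP[+ _] := supA _ _ (GZ (- t)^-1 _ _ Gu).
  rewrite -(ler_pM2l t1) mulrBr -pZ; last exact: ltW.
  rewrite scalerBr !scalerA mulrA divff ?gt_eqF//.
  by rewrite scale1r mul1r scaleNr opprK; lra.
- have /andP[_] := supA _ _ (GZ t^-1 _ _ Gu).
  rewrite -(ler_pM2l t0) mulrBr -pZ; last exact: ltW.
  rewrite scalerDr !scalerA mulrA divff ?gt_eqF//.
  by rewrite scale1r mul1r; lra.
- by rewrite scale0r mul0r !addr0; exact: Gp.
Qed.

(** A maximal linear graph below [p] is total by [graph_extend], and
   single-valued because [r - s <= p 0 = 0] whenever [r] and [s] are both values
   at the same vector. *)
Theorem hahn_banach (V : lmodType R) (p : V -> R)
    (pD : forall u v, p (u + v) <= p u + p v)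
    (pZ : forall a v, 0 <= a -> p (a *: v) = a * p v)
    (G : set (V * R)) :
  G (0, 0) -> graph_linear G -> graph_below p G ->
  exists f : V -> R^o, [/\ linear f, forall v, f v <= p v &
    forall v r, G (v, r) -> f v = r].
Proof.
move=> G0 Glin Gp.
have p0 : p 0 = 0 by rewrite -(scale0r (0 : V)) pZ // mul0r.
(* The empty graph is admitted as the union of the empty chain. *)
pose P := [set A : set (V * R) |
  [/\ graph_linear A, graph_below p A & A !=set0 -> G `<=` A]].
have [A [[Alin Ap AG] Amax]] : exists A, P A /\ forall B, A `<` B -> ~ P B.
  apply: Zorn_bigcup => F FP Ftot; split.
  - move=> a u v r s [B FB Bu] [C FC Cv].
    have [BC|CB] := Ftot _ _ FB FC.
      by exists C => //; have [Cl _ _] := FP _ FC; apply: Cl => //; exact: BC.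
    by exists B => //; have [Bl _ _] := FP _ FB; apply: Bl => //; exact: CB.
  - by move=> v r [B FB Bv]; have [_ Bp _] := FP _ FB; exact: Bp.
  - move=> [q [B FB Bq]] g Gg; exists B => //.
    by have [_ _] := FP _ FB; apply => //; exists q.
have GA : G `<=` A.
  apply: AG; apply: contrapT => /set0P/negP/negPn/eqP A0.
  apply: (Amax G); last by split=> // _ q.
  by rewrite A0; split => // /(_ _ G0).
have A00 : A (0, 0) by exact: GA.
have Atot v : exists r, A (v, r).
  apply: contrapT => nv.
  have [c Bp] := @graph_extend V p pD pZ A v A00 Alin Ap.
  pose B := [set q | exists u r t, A (u, r) /\ q = (u + t *: v, r + t * c)].
  have AB : A `<=` B.
    by move=> [u r] Au; exists u, r, 0; rewrite scale0r mul0r !addr0.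
  apply: (Amax B); last first.
    split => //; last by move=> _; exact: subset_trans AB.
    move=> a _ _ _ _ [u [r [t [Au [-> ->]]]]] [u' [r' [t' [Au' [-> ->]]]]].
    exists (a *: u + u'), (a * r + r'), (a * t + t'); split; first exact: Alin.
    congr (_, _); last by ring.
    by rewrite scalerDr scalerDl scalerA addrACA.
  split => // BA; apply: nv; exists c; apply: BA.
  by exists 0, 0, 1; rewrite scale1r mul1r !add0r.
have Afun v r s : A (v, r) -> A (v, s) -> r = s.
  move=> Ar As; apply/eqP; rewrite eq_le; apply/andP; split.
    have := Ap _ _ (Alin (-1) _ _ _ _ As Ar).
    by rewrite scaleN1r addNr p0; lra.
  have := Ap _ _ (Alin (-1) _ _ _ _ Ar As).
  by rewrite scaleN1r addNr p0; lra.
have [f fA] := choice Atot.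
exists f; split => [a u v|v|v r Gv]; last exact: Afun (fA v) (GA _ Gv).
- by apply: (Afun (a *: u + v)) => //; exact: Alin.
- exact: Ap.
Qed.

Lemma linear_le_seminorm (V : lmodType R) (p : V -> R) (f : V -> R^o) :
  (forall a v, p (a *: v) = `|a| * p v) -> linear f ->
  (forall v, f v <= p v) -> forall v, `|f v| <= p v.
Proof.
move=> pZ flin fp v; rewrite ler_norml; apply/andP; split => //.
have := fp (- v); rewrite -scaleN1r pZ normrN normr1.
have f0 : f 0 = 0 by have := flin (-1) 0 0; rewrite scaler0 addr0 scaleN1r addNr.
by have := flin (-1) v 0; rewrite f0 !addr0 => ->; rewrite scaleN1r; lra.
Qed.

(** Hahn-Banach for the infimal convolution of [a] with the push-forward of [b]
   along [T]: if [v0] cannot be written as [(v0 - T w) + T w] at cost below [d],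
   some functional bounded by both seminorms certifies it.  No infimum is
   formed: the extension takes place on the product [V * W], for the seminorm
   [a + b], from the subspace spanned by [(v0, 0)] and the vectors
   [(- T w, w)]; the required functional is its restriction to [V]. *)
Lemma hahn_banach_dual_pair (V W : lmodType R) (a : V -> R) (b : W -> R)
    (T : {linear W -> V})
    (aD : forall u v, a (u + v) <= a u + a v)
    (aZ : forall t v, a (t *: v) = `|t| * a v)
    (bD : forall u v, b (u + v) <= b u + b v)
    (bZ : forall t v, b (t *: v) = `|t| * b v) (v0 : V) (d : R) :
  0 <= d -> (forall w, d <= a (v0 - T w) + b w) ->
  exists f : V -> R^o, [/\ linear f, f v0 = d, forall v, `|f v| <= a v &
    forall w, `|f (T w)| <= b w].
Proof.
move=> d0 dle.
have ge0 (U : lmodType R) (q : U -> R) :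
    (forall u v, q (u + v) <= q u + q v) ->
    (forall t v, q (t *: v) = `|t| * q v) -> forall u, 0 <= q u.
  move=> qD qZ u; have := qD u (- u).
  by rewrite -scaleN1r qZ scaleN1r subrr -(scale0r (0 : U)) qZ normrN normr0 normr1; lra.
have a0 := ge0 _ _ aD aZ; have b0 := ge0 _ _ bD bZ.
pose p (q : V * W) := a q.1 + b q.2.
pose G : set ((V * W) * R) :=
  [set q | exists t w, q = ((t *: v0 - T w, w), t * d)].
have [|||||F [Flin Fp FG]] := @hahn_banach (V * W)%type p _ _ G.
- by move=> u v; rewrite /p; have := aD u.1 v.1; have := bD u.2 v.2 => /=; lra.
- by move=> t v t0; rewrite /p /= aZ bZ ger0_norm // mulrDr.
- by exists 0, 0; rewrite linear0 scale0r subr0 mul0r.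
- move=> c _ _ _ _ [t [w [-> ->]]] [t' [w' [-> ->]]].
  exists (c * t + t'), (c *: w + w'); congr (_, _); last by ring.
  congr (_, _) => /=.
  by rewrite (linearP T) scalerDl scalerBr scalerA opprD addrACA.
- move=> _ _ [t [w [-> ->]]]; rewrite /p /=.
  have [->|t0] := eqVneq t 0; first by rewrite mul0r; exact: addr_ge0.
  have := dle (t^-1 *: w).
  have nt : 0 < `|t| by rewrite normr_gt0.
  rewrite -(ler_pM2l nt) mulrDr -aZ -bZ scalerBr -linearZ /= !scalerA divff //.
  rewrite scale1r; apply: le_trans; apply: ler_wpM2r => //; exact: ler_norm.
have F0 : F (0, 0) = 0 by apply: FG; exists 0, 0; rewrite linear0 scale0r subr0 mul0r.
have flin : linear (fun v => F (v, 0) : R^o).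
  by move=> c u v; rewrite -Flin; congr (F (_, _)); rewrite /= scaler0 addr0.
have FT w : F (T w, 0) = F (0, w).
  have FTw : F (- T w, w) = 0.
    by apply: FG; exists 0, w; rewrite scale0r sub0r mul0r.
  have := Flin 1 (- T w, w) (T w, 0); rewrite FTw scaler0 add0r scale1r => <-.
  by congr (F (_, _)); rewrite /= ?addNr ?addr0.
exists (fun v => F (v, 0)); split => //.
- by apply: FG; exists 1, 0; rewrite linear0 scale1r subr0 mul1r.
- apply: (linear_le_seminorm aZ) => // v; apply: le_trans (Fp _) _; rewrite /p /=.
  by rewrite (_ : b 0 = 0) ?addr0 // -(scale0r (0 : W)) bZ normr0 mul0r.
- move=> w; rewrite FT; apply: (@linear_le_seminorm _ b (fun w => F (0, w)) bZ) => //.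
    by move=> c u v; rewrite -Flin; congr (F (_, _)); rewrite /= scaler0 addr0.
  move=> v; apply: le_trans (Fp _) _; rewrite /p /=.
  by rewrite (_ : a 0 = 0) ?add0r // -(scale0r (0 : V)) aZ normr0 mul0r.
Qed.

End HahnBanach.

(** * Functionals on a normed space *)

Section DualSpace.
Set Implicit Arguments.
Unset Strict Implicit.
Context {R : realType}.
Implicit Types V : normedModType R.

Lemma submodB (U : lmodType R) (P : submodClosed U) (u v : U) :
  u \in P -> v \in P -> u - v \in P.
Proof. by move=> uP vP; rewrite -scaleN1r; apply: rpredD => //; exact: rpredZ. Qed.

Lemma ler_dual V (f : dual V) (v : V) : `|f v| <= `|f| * `|v|.
Proof. exact: le_opnorm. Qed.

Lemma dualD V (f g : dual V) v : (f + g) v = f v + g v.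
Proof. by []. Qed.

Lemma dualB V (f g : dual V) v : (f - g) v = f v - g v.
Proof. by []. Qed.

Lemma dualZ V a (f : dual V) v : (a *: f) v = a * f v.
Proof. by []. Qed.

Lemma dual_norm_le V (f : dual V) (C : R) :
  0 <= C -> (forall v, `|f v| <= C * `|v|) -> `|f| <= C.
Proof.
move=> C0 fC; apply: ge_sup.
  by exists `|f 0|, 0 => //=; rewrite normr0 ler01.
move=> _ [v /= v1 <-]; apply: le_trans (fC v) _.
by rewrite -[leRHS]mulr1; exact: ler_wpM2l.
Qed.

Lemma dual_of_bounded V (f : V -> R^o) (C : R) :
  linear f -> 0 <= C -> (forall v, `|f v| <= C * `|v|) ->
  exists F : dual V, (forall v, F v = f v) /\ `|F| <= C.
Proof.
move=> flin C0 fC.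
have fcont : continuous f.
  pose l := GRing.isLinear.Build R V R^o _ f flin.
  pose g : {linear V -> R^o} := HB.pack f l.
  apply: (linear_bounded_continuous g).1; apply/bounded_funP => r.
  exists (C * `|r|) => v vr; apply: le_trans (fC v) _.
  by apply: ler_wpM2l => //; apply: le_trans vr _; exact: ler_norm.
have fP : f \in @continuous_functional R V by apply/asboolP; split.
exists (Dual fP); split => //; exact: dual_norm_le.
Qed.

Lemma bidual_eval V (v : V) : exists ev : dual (dual V), forall f, ev f = f v.
Proof.
have [|||ev [evE _]] := @dual_of_bounded (dual V) (fun f => f v) `|v|.
- by [].
- exact: normr_ge0.
- by move=> f; rewrite mulrC; exact: ler_dual.
by exists ev.
Qed.

(** Completeness of the dual, for sequences with an explicit Cauchy modulus [b];
   the limit is formed pointwise and inherits the modulus. *)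
Lemma dual_complete V (S : nat -> dual V) (b : nat -> R) :
  b @ \oo --> 0 -> (forall m n, (m <= n)%N -> `|S n - S m| <= b m) ->
  exists f : dual V, forall m, `|f - S m| <= b m.
Proof.
move=> b0 Sb.
have b_ge0 m : 0 <= b m := le_trans (normr_ge0 _) (Sb m m (leqnn m)).
have Sv m n v : (m <= n)%N -> `|S n v - S m v| <= b m * `|v|.
  move=> mn; rewrite -dualB; apply: le_trans (ler_dual _ v) _.
  by apply: ler_wpM2r => //; exact: Sb.
have cv v : cvgn (fun n => S n v : R^o).
  apply/cauchy_cvgP/cauchy_exP => e e0.
  have bv : (fun n => b n * (`|v| + 1)) @ \oo --> 0.
    by rewrite -[X in _ --> X](mul0r (`|v| + 1)); exact: cvgMr_tmp.
  have v1 : `|v| <= `|v| + 1 by rewrite lerDl ler01.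
  have [N _ bN] : \forall n \near \oo, `|b n * (`|v| + 1)| < e.
    by move/cvgr0Pnorm_lt : bv; apply.
  exists (S N v : R^o); exists N => // n /= Nn; rewrite -ball_normE /= distrC.
  apply: le_lt_trans (Sv _ _ v Nn) _.
  apply: le_lt_trans (bN N (leqnn _)); rewrite ger0_norm ?mulr_ge0 ?addr_ge0 //.
  exact: ler_wpM2l.
pose f v : R^o := limn (fun n => S n v : R^o).
have flin : linear f.
  move=> a u v; apply/cvg_lim => //.
  have -> : (fun n => S n (a *: u + v) : R^o)
      = (fun n => a *: (S n u : R^o) + S n v).
    by apply/funext => n; rewrite linearP.
  apply: cvgD; last exact: cv.
  by apply: cvgZl_tmp; exact: cv.
have fS m v : `|f v - S m v| <= b m * `|v|.
  have cS : (fun n => `|S n v - S m v|) @ \oo --> `|f v - S m v|.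
    by apply: cvg_norm; apply: cvgB; [exact: cv|exact: cvg_cst].
  rewrite -(cvg_lim _ cS) //; apply: limr_le; first by apply/cvg_ex; eexists; exact: cS.
  by exists m => // n /= mn; exact: Sv.
have fC v : `|f v| <= (b 0%N + `|S 0%N|) * `|v|.
  rewrite mulrDl; apply: le_trans (lerD (fS 0%N v) (ler_dual _ _)).
  by apply: le_trans (ler_normD _ _); rewrite subrK.
have [|F [Ff _]] := dual_of_bounded flin _ fC; first exact: addr_ge0.
by exists F => m; apply: dual_norm_le => // v; have := fS m v; rewrite -Ff.
Qed.

Lemma closed_dist_gt0 V (A : set V) (v : V) : closed A -> ~ A v ->
  exists2 d : R, 0 < d & forall y, A y -> d <= `|v - y|.
Proof.
move=> Acl nA; have : nbhs v (~` A).
  by apply: open_nbhs_nbhs; split => //; exact: closed_openC.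
move=> /nbhs_ballP[d /= d0 dA]; exists d => // y Ay.
rewrite leNgt; apply/negP => yd; apply: (dA y) => //.
by rewrite -ball_normE.
Qed.

(** Pairing the norm of [V] with the zero seminorm on [Y] forces the functional to
   vanish on [Y].  The distance from [v] to [Y] appears in the last clause only
   through its lower bounds, which is the form in which it gets estimated. *)
Lemma hahn_banach_dist V (Y : submodClosed V) (v : V) :
  exists h : dual V, [/\ `|h| <= 1, {in Y, forall y, h y = 0} &
    forall d, {in Y, forall y, d <= `|v - y|} -> d <= h v].
Proof.
pose D := [set `|v - y| | y in [set` Y]].
have D0 : lbound D 0 by move=> _ [y _ <-].
have Dne : D !=set0 by exists `|v - 0|, 0 => //=; exact: rpred0.
have iD : 0 <= inf D by exact: lb_le_inf.
have [||||w|f [flin fv fn fY]] := @hahn_banach_dual_pair R V (subsp Y)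
  (fun u => `|u|) (fun=> 0) (val : {linear subsp Y -> V}) _ _ _ _ v (inf D) iD.
- exact: ler_normD.
- exact: normrZ.
- by move=> _ _; rewrite addr0.
- by move=> t _; rewrite mulr0.
- rewrite addr0; apply: ge_inf; first by exists 0.
  by exists (val w) => //=; exact: subsp_valP.
have [|h [hf h1]] := @dual_of_bounded V f 1 flin ler01.
  by move=> u; rewrite mul1r.
exists h; split => // [y yY|d dY].
  by apply/eqP; rewrite hf -normr_le0; exact: (fY (Subsp yY)).
rewrite hf fv; apply: lb_le_inf => // _ [y yY <-]; exact: dY.
Qed.

Lemma hahn_banach_separation V (Y : submodClosed V) (v : V) :
  closed [set` Y] -> v \notin Y ->
  exists2 h : dual V, {in Y, forall y, h y = 0} & h v != 0.
Proof.
move=> Ycl vY; have [|d d0 dY] := @closed_dist_gt0 V _ v Ycl; first exact/negP.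
have [h [_ hY hd]] := hahn_banach_dist Y v; exists h => //.
by rewrite gt_eqF //; apply: lt_le_trans d0 (hd _ dY).
Qed.

Lemma hahn_banach_extension V (Y : submodClosed V) (g : dual (subsp Y)) :
  exists f : dual V, forall y : subsp Y, f (val y) = g y.
Proof.
pose G : set (V * R) := [set q | exists y : subsp Y, q = (val y, g y)].
pose p (v : V) := `|g| * `|v|.
have pD u v : p (u + v) <= p u + p v.
  by rewrite /p -mulrDr; apply: ler_wpM2l => //; exact: ler_normD.
have pZ a v : p (a *: v) = `|a| * p v by rewrite /p normrZ mulrCA.
have [||||f [flin fp fG]] := @hahn_banach R V p pD _ G.
- by move=> a v a0; rewrite pZ ger0_norm.
- by exists 0; rewrite !linear0.
- move=> a _ _ _ _ [y [-> ->]] [y' [-> ->]].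
  by exists (a *: y + y'); rewrite (linearP g).
- move=> _ _ [y [-> ->]]; apply: le_trans (ler_norm _) _; exact: ler_dual.
have fn : forall v, `|f v| <= `|g| * `|v| := linear_le_seminorm pZ flin fp.
have [F [Ff _]] := dual_of_bounded flin (normr_ge0 g) fn.
by exists F => y; rewrite Ff; apply: fG; exists y.
Qed.

End DualSpace.

(** * Closed spans, restriction and norming subspaces *)

Section ClosedSpans.
Set Implicit Arguments.
Unset Strict Implicit.
Context {R : realType} {V : normedModType R}.

Lemma clspan_approx (y : nat -> V) (v : V) : v \in clspan y ->
  forall e, 0 < e -> exists n (a : nat -> R),
    `|v - \sum_(i < n) a i *: y i| < e.
Proof.
move=> /set_mem vy e e0; have [u [[n [a ->]] uv]] := vy _ (nbhsx_ballx v e e0).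
by exists n, a; move: uv; rewrite -ball_normE.
Qed.

Lemma closed_clspan (y : nat -> V) : closed [set` clspan y].
Proof.
rewrite (_ : [set` clspan y] = closure (lin_span y)); first exact: closed_closure.
by apply/seteqP; split => v /=; [move/set_mem|move/mem_set].
Qed.

Lemma clspan_sub (Y : submodClosed V) (y : nat -> V) :
  closed [set` Y] -> (forall i, y i \in Y) -> {subset clspan y <= Y}.
Proof.
move=> Ycl yY v vy; apply: contrapT => vY.
have [d d0 dY] := closed_dist_gt0 Ycl vY.
have [n [a]] := clspan_approx vy d0; rewrite ltNge => /negP; apply; apply: dY.
by apply: rpred_sum => i _; apply: rpredZ.
Qed.

Lemma dual_clspan_eq0 (f : dual V) (y : nat -> V) :
  (forall i, f (y i) = 0) -> {in clspan y, forall v, f v = 0}.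
Proof.
move=> fy v vy; apply: contrapT => /eqP; rewrite -normr_gt0 => fv.
have f1 : 0 < `|f| + 1 by rewrite ltr_wpDl.
have [n [a]] := clspan_approx vy (divr_gt0 fv f1).
rewrite ltr_pdivlMr // ltNge => /negP; apply.
set u := \sum_(i < n) _; have fu : f u = 0.
  by rewrite /u linear_sum big1 // => i _; rewrite linearZ /= fy scaler0.
have := ler_dual f (v - u); rewrite linearB /= fu subr0 => /le_trans; apply.
by rewrite mulrC; apply: ler_wpM2l => //; rewrite lerDl.
Qed.

End ClosedSpans.

Section Restriction.
Set Implicit Arguments.
Unset Strict Implicit.
Context {R : realType} {V : normedModType R} (Y : submodClosed V).

Let restr_subproof (f : dual V) :
  (fun y : subsp Y => f (val y)) \in @continuous_functional R (subsp Y).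
Proof.
have flin : linear (fun y : subsp Y => f (val y) : R^o).
  by move=> a u v; rewrite !linearP.
have [|g [gf _]] := dual_of_bounded flin (normr_ge0 f).
  by move=> y; exact: ler_dual.
rewrite (_ : (fun y => _) = dual_val g); first exact: dual_valP.
by apply/funext => y; rewrite gf.
Qed.

Definition restriction (f : dual V) : dual (subsp Y) := Dual (restr_subproof f).

Lemma restrictionE f y : restriction f y = f (val y).
Proof. by []. Qed.

Lemma restriction_linear : linear restriction.
Proof. by move=> a f g; apply/val_inj/funext. Qed.

HB.instance Definition _ :=
  GRing.isLinear.Build R (dual V) (dual (subsp Y)) _ restriction restriction_linear.

End Restriction.

Section Norming.
Set Implicit Arguments.
Unset Strict Implicit.
Context {R : realType} {V : normedModType R}.

(** The supremum seminorm is always a seminorm dominated by the norm, so being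
   norming amounts to the lower bound; it is phrased through upper bounds [s] to
   keep suprema out of the later estimates. *)
Lemma normingP (Z : submodClosed (dual V)) (Y : {pred V}) :
  norming Z Y <-> exists2 c : R, 0 < c & {in Y, forall y, forall s,
    (forall f, f \in Z -> `|f| <= 1 -> `|f y| <= s) -> c * `|y| <= s}.
Proof.
pose B y := [set `|f y| | f in [set f : dual V | f \in Z /\ `|f| <= 1]].
have B0 y : B y !=set0.
  exists `|(0 : dual V) y|, 0 => //; split; first exact: rpred0.
  by rewrite normr0 ler01.
have le_p y s : (forall f, f \in Z -> `|f| <= 1 -> `|f y| <= s) -> sup (B y) <= s.
  by move=> fs; apply: ge_sup => // _ [f [fZ f1] <-]; exact: fs.
have fy1 y (f : dual V) : `|f| <= 1 -> `|f y| <= `|y|.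
  move=> f1; apply: le_trans (ler_dual _ _) _.
  by rewrite -[leRHS]mul1r; exact: ler_wpM2r.
have p_ge y f : f \in Z -> `|f| <= 1 -> `|f y| <= sup (B y).
  move=> fZ f1; apply: ub_le_sup; last by exists f.
  by exists `|y| => _ [g [_ g1] <-]; exact: fy1.
split=> [[_ _ _ [c [C [c0 _ cC]]]]|[c c0 cY]].
  exists c => // y yY s fs; have /andP[cy _] := cC y yY.
  exact: le_trans cy (le_p _ _ fs).
have pZ_le a y : sup (B (a *: y)) <= `|a| * sup (B y).
  apply: le_p => f fZ f1; rewrite linearZ /= normrZ; apply: ler_wpM2l => //.
  exact: p_ge.
have cB y : y \in Y -> c * `|y| <= sup (B y).
  by move=> yY; apply: cY => // f; exact: p_ge.
split.
- move=> u v _ _; apply: le_p => f fZ f1; rewrite linearD /=.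
  by apply: le_trans (ler_normD _ _) _; apply: lerD; exact: p_ge.
- move=> a y _; apply/eqP; rewrite eq_le pZ_le /=.
  have [->|a0] := eqVneq a 0.
    rewrite normr0 mul0r; apply: le_trans (p_ge (0 *: y) 0 _ _) => //.
      exact: rpred0.
    by rewrite normr0.
  have := pZ_le a^-1 (a *: y); rewrite scalerA mulVf // scale1r normfV.
  by rewrite ler_pdivlMl ?normr_gt0.
- move=> y yY p0; have := cB y yY; rewrite [sup _]p0 pmulr_rle0 //.
  by rewrite normr_le0 => /eqP.
- exists c, 1; split => // y yY; rewrite cB //= mul1r.
  by apply: le_p => f _; exact: fy1.
Qed.

(** A bidual functional of [Y], composed with restriction from [X] to [Y], is the
   evaluation at some point of [X].  That point lies in [Y], for otherwise a
   functional vanishing on [Y] would separate it; and functionals on [Y] extend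
   to [V], so the evaluation formula covers all of them. *)
Lemma reflexive_subspace (X Y : submodClosed V) :
  closed [set` Y] -> {subset Y <= X} ->
  reflexive_space (subsp X) -> reflexive_space (subsp Y).
Proof.
move=> Ycl YX reflX phi.
pose iota (y : subsp Y) : subsp X := Subsp (YX _ (subsp_valP y)).
have ilin (g : dual (subsp X)) : linear (fun y => g (iota y) : R^o).
  by move=> a u v; rewrite -linearP; congr (g _); exact: val_inj.
have /choice[rest restP] (g : dual (subsp X)) :
    exists h : dual (subsp Y), (forall y, h y = g (iota y)) /\ `|h| <= `|g|.
  have := @dual_of_bounded R (subsp Y) _ `|g| (ilin g) (normr_ge0 g); apply.
  by move=> y; exact: (ler_dual g (iota y)).
have restlin : linear rest.
  move=> a g h; apply/val_inj/funext => y /=.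
  by rewrite (restP _).1 [RHS]/(a * rest g y + rest h y) !(restP _).1.
have [|||Phi [PhiE _]] := @dual_of_bounded R (dual (subsp X)) (fun g => phi (rest g)) `|phi|.
- by move=> a g h; rewrite restlin linearP.
- by [].
- move=> g; apply: le_trans (ler_dual _ _) _; apply: ler_wpM2l => //.
  exact: (restP g).2.
have [x xPhi] := reflX Phi.
have xY : val x \in Y.
  apply: contrapT => /negP nY; have [h hY hx] := hahn_banach_separation Ycl nY.
  have := xPhi (restriction X h); rewrite PhiE /= => hx0.
  move/eqP: hx; apply; rewrite -[LHS]hx0.
  rewrite (_ : rest _ = 0) ?linear0 //; apply/val_inj/funext => y /=.
  rewrite (restP _).1; apply: hY; exact: subsp_valP.
exists (Subsp xY) => g; have [G Gg] := hahn_banach_extension g.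
have <- : rest (restriction X G) = g.
  by apply/val_inj/funext => y /=; rewrite (restP _).1 -Gg.
rewrite -PhiE xPhi (restP _).1; congr (dual_val _ _); exact: val_inj.
Qed.

End Norming.

(** * Lifting functionals to a norming subspace *)

Section Lifting.
Set Implicit Arguments.
Unset Strict Implicit.
Context {R : realType}.

Lemma cvg_mul_half_pow (B : R) : (fun n => B * 2^-1 ^+ n) @ \oo --> 0.
Proof. by apply: cvg_geometric; rewrite ger0_norm ?invr_ge0 // invf_lt1 ?ltr1n. Qed.

Lemma mul_half_pow_lt (B d : R) : 0 < d -> exists n, B * 2^-1 ^+ n < d.
Proof.
move=> d0; have /cvgr0Pnorm_lt/(_ _ d0)[N _ BN] := @cvg_mul_half_pow B.
by exists N; apply: le_lt_trans (ler_norm _) (BN N (leqnn N)).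
Qed.

Context {V : normedModType R} (Y : submodClosed V) (Z : submodClosed (dual V)).

(** If the total cost [4 / c * `|g - restriction Y w| + `|w|] stayed above
   [2 / c * `|g|] for all [w] in [Z], Hahn-Banach and reflexivity would produce
   [y] in [Y] with [g y = 2 / c * `|g|] on which the unit ball of [Z] is bounded
   by 1; but then [c * `|y| <= 1], which makes [g y] at most [`|g| / c].  The
   weight [4 / c] is what turns the cost bound into an error of [`|g| / 2]. *)
Lemma norming_approx_lift (c : R) : 0 < c ->
  {in Y, forall y, forall s,
    (forall f, f \in Z -> `|f| <= 1 -> `|f y| <= s) -> c * `|y| <= s} ->
  reflexive_space (subsp Y) ->
  forall g : dual (subsp Y), exists w : dual V, [/\ w \in Z,
    `|w| <= 2 / c * `|g| & `|g - restriction Y w| <= 2^-1 * `|g|].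
Proof.
move=> c0 cY reflY g.
have [->|g0] := eqVneq g 0.
  exists 0; rewrite rpred0 linear0 subr0 !normr0 !mulr0; split => //.
have ng : 0 < `|g| by rewrite normr_gt0.
pose N := 4 / c; have N0 : 0 < N by exact: divr_gt0.
pose d := 2 / c * `|g|; have d0 : 0 < d by rewrite mulr_gt0 // divr_gt0.
have [w wd] : exists w : subsp Z, N * `|g - restriction Y (val w)| + `|w| < d.
  apply: contrapT => nw.
  have dle (w : subsp Z) : d <= N * `|g - (restriction Y \o val) w| + `|w|.
    by rewrite leNgt; apply/negP => wd; apply: nw; exists w.
  have [||||phi [phin phig phiN phiZ]] := @hahn_banach_dual_pair R
    (dual (subsp Y)) (subsp Z) (fun h => N * `|h|) (fun w => `|w|)
    (restriction Y \o val) _ _ _ _ g d (ltW d0) dle.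
  - by move=> u v; rewrite -mulrDr; apply: ler_wpM2l; [exact: ltW|exact: ler_normD].
  - by move=> t v; rewrite normrZ mulrCA.
  - exact: ler_normD.
  - exact: normrZ.
  have [Phi [PhiE _]] := dual_of_bounded phin (ltW N0) phiN.
  have [y yPhi] := reflY Phi.
  have yle : c * `|y| <= 1.
    apply: cY; first exact: subsp_valP.
    move=> f fZ f1; apply: le_trans f1.
    have := phiZ (Subsp fZ); rewrite -PhiE yPhi; exact.
  have := ler_dual g y; rewrite -yPhi PhiE phig ger0_norm; last exact: ltW.
  rewrite leNgt => /negP; apply; rewrite /d [ltRHS]mulrC ltr_pM2l //.
  rewrite ltr_pdivlMr // mulrC; apply: le_lt_trans yle _; exact: ltr1n.
exists (val w); split; first exact: subsp_valP.
  apply: ltW; apply: le_lt_trans wd; rewrite lerDr; apply: mulr_ge0 => //; exact: ltW.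
rewrite -(ler_pM2l N0); apply: ltW; have := normr_ge0 w.
have -> : N * (2^-1 * `|g|) = d by rewrite /N /d; field; rewrite gt_eqF.
move: wd; lra.
Qed.

(** As in the open mapping theorem, approximate lifts with halved errors are
   summed to an exact lift; [r n] is the error left after [n] steps. *)
Lemma norming_lift :
  closed [set` Z] -> norming Z Y -> reflexive_space (subsp Y) ->
  exists2 C : R, 0 <= C & forall g : dual (subsp Y), exists w : dual V,
    [/\ w \in Z, restriction Y w = g & `|w| <= C * `|g|].
Proof.
move=> Zcl /normingP[c c0 cY] reflY.
have /choice[W WP] := norming_approx_lift c0 cY reflY.
exists (2 * (2 / c)); first by rewrite mulr_ge0 // divr_ge0 // ltW.
move=> g; set C := 2 * (2 / c).
pose r n := iter n (fun h => h - restriction Y (W h)) g.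
pose S n := \sum_(i < n) W (r i).
pose q : R := 2^-1.
have rS n : g - restriction Y (S n) = r n.
  elim: n => [|n IH]; first by rewrite /S big_ord0 linear0 subr0.
  by rewrite /S big_ord_recr /= linearD opprD addrA IH.
have rle n : `|r n| <= `|g| * q ^+ n.
  elim: n => [|n IH]; first by rewrite expr0 mulr1.
  have [_ _ rn] := WP (r n); apply: le_trans rn _.
  rewrite exprS mulrCA; apply: ler_wpM2l => //; by rewrite invr_ge0.
pose B := C * `|g|.
have C0 : 0 <= C by rewrite mulr_ge0 // divr_ge0 // ltW.
have B0 : 0 <= B by exact: mulr_ge0.
have wle n : `|W (r n)| <= B * q ^+ n.+1.
  have [_ + _] := WP (r n); move/le_trans; apply.
  have -> : B * q ^+ n.+1 = 2 / c * (`|g| * q ^+ n).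
    by rewrite /B /C exprS /q; field; rewrite gt_eqF.
  by apply: ler_wpM2l; rewrite ?divr_ge0 // ltW.
have SB m n : (m <= n)%N -> `|S n - S m| <= B * q ^+ m.
  (* This sharper bound telescopes along the induction on [n - m]. *)
  move=> mn; suff : `|S n - S m| <= B * q ^+ m - B * q ^+ n.
    move/le_trans; apply; rewrite lerBlDr lerDl.
    by rewrite mulr_ge0 // exprn_ge0 // invr_ge0.
  rewrite -(subnK mn); elim: (n - m)%N => [|k IH]; first by rewrite !subrr normr0.
  rewrite addSn {1}/S big_ord_recr /= -/(S _) addrAC.
  apply: le_trans (ler_normD _ _) _; apply: le_trans (lerD IH (wle _)) _.
  by rewrite exprS /q; lra.
have [f fS] := dual_complete (cvg_mul_half_pow B) SB.
have SZ n : S n \in Z by apply: rpred_sum => i _; have [] := WP (r i).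
exists f; split.
- apply: contrapT => fZ; have [d d0 dZ] := closed_dist_gt0 Zcl fZ.
  have [n] := mul_half_pow_lt B d0; rewrite ltNge => /negP; apply.
  exact: le_trans (dZ _ (SZ n)) (fS n).
- apply/esym/eqP; rewrite -subr_eq0; apply: contrapT => /negP.
  rewrite -normr_gt0 => gf; have [n] := mul_half_pow_lt (`|g| + B) gf.
  rewrite ltNge => /negP; apply.
  have -> : g - restriction Y f = r n - restriction Y (f - S n).
    by rewrite -rS linearB /= opprB addrA subrK.
  apply: le_trans (ler_normB _ _) _; rewrite mulrDl; apply: lerD => //.
  apply: le_trans (fS n); apply: dual_norm_le => // y.
  rewrite restrictionE; exact: (ler_dual (f - S n) (val y)).
- by have := fS 0%N; rewrite /S big_ord0 subr0 expr0 mulr1.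
Qed.

(** Lifts from the dual of [Y] to [Z] are unique, hence linear and bounded, so
   [phi] composed with lifting is a bidual functional of the reflexive [Y]. *)
Lemma bidual_eval_on :
  closed [set` Z] -> norming Z Y -> reflexive_space (subsp Y) ->
  {in Z, forall w : dual V, {in Y, forall y, w y = 0} -> w = 0} ->
  forall phi : dual (dual V), exists2 y, y \in Y & {in Z, forall w, phi w = w y}.
Proof.
move=> Zcl normZ reflY Zinj phi.
have [C C0 /choice[s sP]] := norming_lift Zcl normZ reflY.
have sZ g : s g \in Z by have [] := sP g.
have sE g (y : subsp Y) : s g (val y) = g y.
  by have [_ sg _] := sP g; rewrite -[RHS](congr1 (fun h => dual_val h y) sg).
have slin : linear (fun g => phi (s g) : R^o).
  move=> a g h; rewrite -linearP; congr (phi _).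
  apply/eqP; rewrite -subr_eq0; apply/eqP; apply: Zinj => [|y yY].
    by apply: submodB; rewrite ?sZ //; apply: rpredD; rewrite ?rpredZ ?sZ.
  by rewrite dualB dualD dualZ !(sE _ (Subsp yY)) dualD dualZ subrr.
have [||psi [psiE _]] := @dual_of_bounded R (dual (subsp Y)) _ (`|phi| * C) slin.
- exact: mulr_ge0.
- move=> g; apply: le_trans (ler_dual _ _) _; rewrite -mulrA.
  by apply: ler_wpM2l => //; have [] := sP g.
have [y yP] := reflY psi; exists (val y); first exact: subsp_valP.
move=> w wZ; rewrite -restrictionE -yP psiE; congr (phi _).
apply/esym/eqP; rewrite -subr_eq0; apply/eqP; apply: Zinj => [|u uY].
  exact: submodB.
by rewrite dualB (sE _ (Subsp uY)) restrictionE subrr.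
Qed.

End Lifting.

(** * Perturbing a bounded system *)

Section Perturbation.
Set Implicit Arguments.
Unset Strict Implicit.
Context {R : realType} {V : normedModType R}.

Lemma separable_dense_seq : separable V ->
  exists d : nat -> V, forall v e, 0 < e -> exists k, `|v - d k| < e.
Proof.
move=> [D [/countable_injP[j jinj] Ddense]].
have Dnear v e : 0 < e -> exists2 u, D u & `|v - u| < e.
  move=> e0; have [||u [uv Du]] := Ddense (ball v e).
  - by exists v; exact: ballxx.
  - exact: ball_open.
  - by exists u => //; move: uv; rewrite -ball_normE.
have /choice[d dP] k : exists u, forall w, D w -> j w = k -> w = u.
  have [[u [Du ju]]|nu] := pselect (exists u, D u /\ j u = k).
    by exists u => w Dw jw; apply: jinj; rewrite ?inE // jw.
  by exists 0 => w Dw jw; case: nu; exists w.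
exists d => v e e0; have [u Du uv] := Dnear v e e0.
by exists (j u); rewrite -(dP _ u Du).
Qed.

Lemma infinitely_repeating_index :
  exists k : nat -> nat, forall m n, exists2 i, (n <= i)%N & k i = m.
Proof.
(* The integers with 2-adic valuation [m] are the [2 ^ m] times an odd number. *)
exists (fun i => logn 2 i.+1) => m n; exists (2 ^ m * n.*2.+1).-1.
  rewrite -ltnS prednK ?muln_gt0 ?expn_gt0 //.
  apply: (@leq_trans n.*2.+1); first by rewrite ltnS -addnn leq_addr.
  by rewrite leq_pmull // expn_gt0.
rewrite prednK ?muln_gt0 ?expn_gt0 //.
rewrite lognM ?expn_gt0 // pfactorK // logn_coprime ?addn0 //.
by rewrite coprime2n /= odd_double.
Qed.

(** The coefficient functionals of the M-basis [z] agree with the evaluations at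
   the [x i] on each [z j], hence on the whole closed span.  So the totality in
   the definition of an M-basis is totality of the [x i]. *)
Lemma Mbasis_clspan_total (x : nat -> V) (z : nat -> dual V) :
  biorthogonal x z -> M_basis (in_clspan z) ->
  {in clspan z, forall w : dual V, (forall i, w (x i) = 0) -> w = 0}.
Proof.
move=> xz [zspan [xs [xs_z xs_total]]] w wz wx.
pose w' : subsp (clspan z) := Subsp wz.
suff : w' = 0 by move/(congr1 val).
have xsE i (u : subsp (clspan z)) : xs i u = (val u) (x i).
  have [ev evE] := bidual_eval (x i).
  suff: (xs i - restriction (clspan z) ev) u = 0.
    by rewrite dualB restrictionE evE => /eqP; rewrite subr_eq0 => /eqP.
  apply: (dual_clspan_eq0 (y := in_clspan z)) => [k|]; last exact: zspan.
  by rewrite dualB restrictionE evE xs_z /= xz eq_sym subrr.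
apply: xs_total => // f fxs.
have [ev evE] := bidual_eval w'.
rewrite -evE; apply: (dual_clspan_eq0 (y := xs)) fxs => i.
by rewrite evE xsE wx.
Qed.

(** On a finite combination of the [x j] the functional [z i] vanishes for large
   [i], and [`|x i| * `|z i|] is bounded, which controls the approximation error
   uniformly in [i]. *)
Lemma bounded_system_eval_small (x : nat -> V) (z : nat -> dual V) (y : V) :
  biorthogonal x z -> bounded_system x z -> y \in clspan x ->
  forall e, 0 < e -> exists N, forall i, (N <= i)%N -> `|x i| * `|z i y| < e.
Proof.
move=> xz [M MP] yx e e0.
have MB i : `|x i| * `|z i| <= M by apply: MP; exists i.
have M0 : 0 <= M by apply: le_trans (MB 0%N); exact: mulr_ge0.
have M1 : 0 < M + 1 by rewrite ltr_wpDl.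
have [N [a ya]] := clspan_approx yx (divr_gt0 e0 M1).
exists N => i Ni; set u := \sum_(k < N) _ in ya.
have zu : z i u = 0.
  rewrite /u linear_sum big1 // => k _; rewrite linearZ /= xz.
  by rewrite gtn_eqF ?scaler0 // (leq_trans (ltn_ord k)).
have -> : z i y = z i (y - u) by rewrite linearB /= zu subr0.
apply: (@le_lt_trans _ _ ((M + 1) * `|y - u|)); last by rewrite mulrC -ltr_pdivlMr.
apply: (@le_trans _ _ (`|x i| * (`|z i| * `|y - u|))).
  by apply: ler_wpM2l => //; exact: ler_dual.
rewrite mulrA; apply: ler_wpM2r => //; apply: le_trans (MB i) _.
by rewrite lerDl.
Qed.

(** A vector [v] at distance less than [t * `|v|] from [Y] is normed by [Z], up to
   an error of the order of [t]; otherwise [h k] norms [v] as soon as [d k] is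
   close enough to it. *)
Lemma norming_extend (Y : submodClosed V) (Z Z' : submodClosed (dual V))
    (d : nat -> V) (h : nat -> dual V) :
  norming Z Y -> {subset Z <= Z'} ->
  (forall v e, 0 < e -> exists k, `|v - d k| < e) ->
  (forall k, h k \in Z') -> (forall k, `|h k| <= 1) ->
  (forall k t, {in Y, forall y, t <= `|d k - y|} -> t <= h k (d k)) ->
  norming Z' predT.
Proof.
move=> /normingP[c c0 cY] ZZ' ddense hZ' h1 hd; apply/normingP.
have c1 : 0 < 2 * (1 + c) by rewrite mulr_gt0 // addr_gt0.
(* This [t] balances the two cases: [c * (1 - t) - t = c / 2]. *)
pose t := c / (2 * (1 + c)); have t0 : 0 < t by exact: divr_gt0.
have tc : t * (1 + c) = c / 2 by rewrite /t; field; rewrite gt_eqF // addr_gt0.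
exists (t / 2) => [|v _ s sv]; first exact: divr_gt0.
have [->|v0] := eqVneq v 0.
  rewrite normr0 mulr0; apply: le_trans (sv 0 _ _); rewrite ?normr0 //.
  exact: rpred0.
have nv : 0 < `|v| by rewrite normr_gt0.
have [[y yY vy]|far] := pselect (exists2 y, y \in Y & `|v - y| < t * `|v|).
  have cy : c * `|y| <= s + `|v - y|.
    apply: cY => // f fZ f1; have -> : f y = f v - f (v - y).
      by rewrite linearB /= opprB addrC subrK.
    apply: le_trans (ler_normB _ _) _; apply: lerD; first exact: sv (ZZ' _ fZ) f1.
    by apply: le_trans (ler_dual _ _) _; rewrite -[leRHS]mul1r; exact: ler_wpM2r.
  have vle : `|v| <= `|v - y| + `|y| by rewrite -{1}(subrK y v); exact: ler_normD.
  have cv : c * `|v| <= c * (`|v - y| + `|y|) by apply: ler_wpM2l => //; exact: ltW.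
  have cvy : c * `|v - y| <= c * (t * `|v|) by apply: ler_wpM2l; exact: ltW.
  have tcv : (t * (1 + c)) * `|v| = c / 2 * `|v| by rewrite tc.
  have tv : 0 <= (t * c) * `|v| by apply: mulr_ge0 => //; apply: mulr_ge0; exact: ltW.
  have tv0 : 0 <= t * `|v| by rewrite mulr_ge0 // ltW.
  move: cy cv cvy tcv tv; lra.
have [k vk] := ddense v (t / 4 * `|v|) (mulr_gt0 (divr_gt0 t0 (ltr0n _ 4)) nv).
have hk : t * `|v| - t / 4 * `|v| <= h k (d k).
  apply: hd => y yY; have tvy : t * `|v| <= `|v - y|.
    by rewrite leNgt; apply/negP => vy; apply: far; exists y.
  have := ler_distD (d k) v y; lra.
have hv : `|h k (v - d k)| <= t / 4 * `|v|.
  apply: le_trans (ltW vk); apply: le_trans (ler_dual _ _) _.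
  by rewrite -[leRHS]mul1r; exact: ler_wpM2r.
have := sv _ (hZ' k) (h1 k); have -> : h k v = h k (d k) + h k (v - d k).
  by rewrite linearB /= addrC subrK.
move=> hs; have := ler_norm (h k (d k) + h k (v - d k)).
by have := ler_norm (- h k (v - d k)); rewrite normrN; lra.
Qed.

(** Otherwise a bidual functional [phi] vanishes on every perturbed vector but not
   on [h m].  Then [`|x i| * phi (z i) = - phi (h m)] whenever [k i = m], whereas
   [phi (z i) = z i y] for some [y] in the closed span of [x], and
   [`|x i| * z i y] tends to 0. *)
Lemma perturbation_in_clspan (x : nat -> V) (z h : nat -> dual V)
    (k : nat -> nat) :
  biorthogonal x z -> bounded_system x z ->
  (forall m n, exists2 i, (n <= i)%N & k i = m) ->
  (forall phi : dual (dual V),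
    exists2 y, y \in clspan x & {in clspan z, forall w, phi w = w y}) ->
  forall m, h m \in clspan (fun i => z i + `|x i|^-1 *: h (k i)).
Proof.
move=> xz bxz kinf evalP m; apply: contrapT => /negP hm.
have [phi phif phih] := hahn_banach_separation (@closed_clspan _ _ _) hm.
have [y yx yP] := evalP phi.
have ph : 0 < `|phi (h m)| by rewrite normr_gt0.
have [N NP] := bounded_system_eval_small xz bxz yx ph.
have [i Ni ki] := kinf m N.
have xi : `|x i| != 0.
  rewrite normr_eq0; apply/eqP => xi0; have := xz i i.
  by rewrite xi0 linear0 eqxx => /eqP; rewrite eq_sym oner_eq0.
have := phif _ (mem_clspan (fun i => z i + `|x i|^-1 *: h (k i)) i).
rewrite linearD linearZ /= ki yP ?mem_clspan // => /eqP.
rewrite addr_eq0 => /eqP zy; have := NP _ Ni.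
by rewrite zy normrN normrZ normfV normr_id mulrA divff // mul1r ltxx.
Qed.

End Perturbation.

(** * The norming biorthogonal sequence *)

Theorem corollary5 (R : realType) (E : completeNormedModType R)
    (X : submodClosed E) (x : nat -> E) (z : nat -> dual E)
    (sepE : separable E)
    (closedX : closed [set` X])
    (reflX : reflexive_space (subsp X))
    (xX : forall i, x i \in X)
    (bounded_xz : bounded_system x z)
    (bibasic_xz : M_bibasic x z)
    (norming_z : norming (clspan z) (clspan x)) :
  exists f : nat -> dual E,
    [/\ biorthogonal x f,
        bounded_system x f,
        (exists2 c : R, 0 < c & forall i, c <= `|x i|) -> bounded_fun f &
        norming (clspan f) predT].
Proof.
have [xz _ Mz] := bibasic_xz.
have reflF : reflexive_space (subsp (clspan x)).
  by apply: reflexive_subspace reflX; [exact: closed_clspan|exact: clspan_sub].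
have evalP (phi : dual (dual E)) :
    exists2 y, y \in clspan x & {in clspan z, forall w, phi w = w y}.
  apply: bidual_eval_on => //; first exact: closed_clspan.
  move=> w wz wx; apply: (Mbasis_clspan_total xz Mz wz) => i.
  by apply: wx; exact: mem_clspan.
have [d ddense] := separable_dense_seq sepE.
have [k kinf] := infinitely_repeating_index.
have /choice[h hP] m := hahn_banach_dist (clspan x) (d m).
pose f i := z i + `|x i|^-1 *: h (k i).
have hf : forall m, h m \in clspan f by exact: perturbation_in_clspan.
have zf : {subset clspan z <= clspan f}.
  apply: clspan_sub => [|i]; first exact: closed_clspan.
  rewrite -[z i](addrK (`|x i|^-1 *: h (k i))).
  by apply: submodB; [exact: mem_clspan|apply: rpredZ].
have bxf : bounded_system x f.
  have [M MP] := bounded_xz; exists (M + 1) => _ [i _ <-].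
  apply: le_trans (ler_wpM2l (normr_ge0 _) (ler_normD _ _)) _.
  rewrite mulrDr; apply: lerD; first by apply: MP; exists i.
  rewrite normrZ normfV normr_id mulrA.
  have [hm1 _ _] := hP (k i); have [->|xi] := eqVneq `|x i| 0.
    by rewrite !mul0r ler01.
  by rewrite divff // mul1r.
exists f; split.
- move=> i j; rewrite dualD dualZ; have [_ hx _] := hP (k i).
  by rewrite hx ?mem_clspan // mulr0 addr0; exact: xz.
- exact: bxf.
- move=> [c c0 cx]; have [M MP] := bxf.
  have fM i : `|f i| <= M / c.
    rewrite ler_pdivlMr // mulrC; apply: le_trans (MP _ (ex_intro2 _ _ i I erefl)).
    exact: ler_wpM2r.
  exists (M / c); split; first exact: num_real.
  by move=> r Mr i _; apply: le_trans (fM i) (ltW Mr).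
- apply: norming_extend norming_z zf ddense hf _ _ => [m|m t dt].
    by have [] := hP m.
  by have [_ _] := hP m; apply.
Qed.
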